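(* Let $ABC$ be a triangle and let $P$ be any point (ordinary or at infinity) not on the extended sides of $ABC$ or of its anticomplementary triangle. Then the generalized circumcenter $O$ and the generalized orthocenter $H$ of $P$ with respect to $ABC$ exist (that is, the three lines through $D_0,E_0,F_0$ parallel respectively to $QD,QE,QF$ are concurrent, at $O$, and the three lines through $A,B,C$ parallel respectively to $QD,QE,QF$ are concurrent, at $H$), and they are given by $$O=T_{P'}^{-1}K(Q),\qquad H=K^{-1}T_{P'}^{-1}K(Q).$$
   Context: We work in the Euclidean plane extended by the line at infinity $l_\infty$. Points not on $l_\infty$ are called ordinary; affine maps act on the extended plane. Two lines are parallel ($\parallel$) if they meet $l_\infty$ in the same point (a line is parallel to itself). $X\cdot Y$-type products of lines, such as $AP\cdot BC$, denote intersection points; juxtaposition of maps is composition. $ABC$ is a triangle with centroid $G$; $D_0,E_0,F_0$ are the midpoints of $BC,CA,AB$. $K$ is the complement map, the homothety with center $G$ and ratio $-1/2$; $K^{-1}(ABC)$ is the anticomplementary triangle. $P$ is a point (ordinary or infinite) not on the extended sides of $ABC$ or $K^{-1}(ABC)$. $D=AP\cdot BC$, $E=BP\cdot CA$, $F=CP\cdot AB$ are its traces. $D_3,E_3,F_3$ are the reflections of $D,E,F$ in $D_0,E_0,F_0$; the lines $AD_3,BE_3,CF_3$ concur in $P'=\iota(P)$, the isotomic conjugate of $P$ (in barycentric coordinates $\iota(x:y:z)=(1/x:1/y:1/z)$). $Q=K(P')$. $T_{P'}$ is the unique affine map taking $A,B,C$ to $D_3,E_3,F_3$. Definition: the generalized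 circumcenter $O$ of $P$ is the point lying on the lines through $D_0,E_0,F_0$ parallel respectively to $QD,QE,QF$ (so $OD_0\parallel QD$, $OE_0\parallel QE$, $OF_0\parallel QF$). The generalized orthocenter $H$ of $P$ is the point lying on the lines through $A,B,C$ parallel respectively to $QD,QE,QF$ (so $HA\parallel QD$, $HB\parallel QE$, $HC\parallel QF$). *)

(* Defs.v *)
From HB Require Import structures.
From mathcomp Require Import all_boot all_order all_algebra.
From mathcomp Require Import reals.

Set Implicit Arguments.
Unset Strict Implicit.
Unset Printing Implicit Defensive.

Import Order.TTheory GRing.Theory Num.Theory.

Local Open Scope ring_scope.

(* The extended plane is the projective plane of R^3: its points and lines are
   the linear subspaces of dimension 1 and 2, the line joining two points is
   their sum, the common points of two lines form their intersection, and
   incidence is inclusion. *)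
Notation flat R := {vspace 'rV[R]_(2 + 1)}.

Definition is_point (R : realType) (U : flat R) : bool := \dim U == 1%N.

Definition is_line (R : realType) (U : flat R) : bool := \dim U == 2%N.

(* The ordinary point x of R^2 has homogeneous coordinates (x, 1). *)
Definition pt (R : realType) (x : 'rV[R]_2) : flat R :=
  <[row_mx x 1%:M]>%VS.

(* The subspace on which the last homogeneous coordinate vanishes. *)
Definition linf (R : realType) : flat R :=
  lker (linfun (fun v : 'rV[R]_(2 + 1) => rsubmx v)).

Definition ordinary (R : realType) (U : flat R) : bool :=
  is_point U && ~~ (U <= linf R)%VS.

Definition parallel (R : realType) (l m : flat R) : Prop :=
  (l :&: linf R)%VS = (m :&: linf R)%VS.

(* The join of X with the point at infinity of m; see parallel_throughP. *)
Definition parallel_through (R : realType) (X m : flat R) : flat R :=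
  (X + (m :&: linf R))%VS.

Definition concurrent_at (R : realType) (X l m n : flat R) : Prop :=
  is_point X /\ (l :&: m :&: n)%VS = X.

(* The affine map x |-> x *m aff_lin + aff_tr of R^2. *)
Record affine_map (R : realType) := AffineMap {
  aff_lin : 'M[R]_2;
  aff_tr : 'rV[R]_2
}.

Definition aff_invertible (R : realType) (f : affine_map R) : bool :=
  aff_lin f \in unitmx.

(* The inverse map, when f is invertible. *)
Definition aff_inv (R : realType) (f : affine_map R) : affine_map R :=
  AffineMap (invmx (aff_lin f)) (- (aff_tr f *m invmx (aff_lin f))).

(* The action on the extended plane: the block matrix sends the homogeneous
   coordinates (x, 1) to (x *m aff_lin f + aff_tr f, 1). *)
Definition act (R : realType) (f : affine_map R) (U : flat R) : flat R :=
  (linfun (mulmxr (block_mx (aff_lin f) 0 (aff_tr f) 1%:M)) @: U)%VS.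

(* x |-> c + k (x - c) *)
Definition homothety (R : realType) (c : 'rV[R]_2) (k : R) : affine_map R :=
  AffineMap k%:M (c - k *: c).

Definition point_reflection (R : realType) (c : 'rV[R]_2) : affine_map R :=
  homothety c (-1).

Definition midpoint (R : realType) (X Y : 'rV[R]_2) : 'rV[R]_2 :=
  2^-1 *: (X + Y).

Definition centroid (R : realType) (A B C : 'rV[R]_2) : 'rV[R]_2 :=
  3^-1 *: (A + B + C).

Definition complement_map (R : realType) (A B C : 'rV[R]_2) : affine_map R :=
  homothety (centroid A B C) (- 2^-1).

Definition side (R : realType) (X Y : 'rV[R]_2) : flat R := (pt X + pt Y)%VS.

(* The vertices are not collinear. *)
Definition is_triangle (R : realType) (A B C : 'rV[R]_2) : bool :=
  \dim (pt A + pt B + pt C)%VS == 3%N.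

Definition off_sides (R : realType) (A B C : 'rV[R]_2) (P : flat R) : bool :=
  [&& ~~ (P <= side B C)%VS, ~~ (P <= side C A)%VS & ~~ (P <= side A B)%VS].

Definition off_anticomplementary_sides (R : realType) (A B C : 'rV[R]_2)
    (P : flat R) : bool :=
  let Kinv := aff_inv (complement_map A B C) in
  [&& ~~ (P <= act Kinv (side B C))%VS, ~~ (P <= act Kinv (side C A))%VS
    & ~~ (P <= act Kinv (side A B))%VS].

(* The trace of P on YZ from the vertex X of the triangle XYZ: thus
   D = trace A B C P, E = trace B C A P and F = trace C A B P. *)
Definition trace (R : realType) (X Y Z : 'rV[R]_2) (P : flat R) : flat R :=
  ((pt X + P) :&: side Y Z)%VS.

(* D_3, E_3, F_3 are respectively refl_trace A B C P, refl_trace B C A P and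
   refl_trace C A B P. *)
Definition refl_trace (R : realType) (X Y Z : 'rV[R]_2) (P : flat R) : flat R :=
  act (point_reflection (midpoint Y Z)) (trace X Y Z P).

(* The point of concurrence of A D_3, B E_3, C F_3. *)
Definition isotomic (R : realType) (A B C : 'rV[R]_2) (P : flat R) : flat R :=
  ((pt A + refl_trace A B C P) :&: (pt B + refl_trace B C A P)
     :&: (pt C + refl_trace C A B P))%VS.

(* Q = K(P') *)
Definition isotomcomplement (R : realType) (A B C : 'rV[R]_2) (P : flat R) :
    flat R :=
  act (complement_map A B C) (isotomic A B C P).

(* T sends A, B, C to D_3, E_3, F_3, the traces of P'. *)
Definition sends_to_refl_traces (R : realType) (A B C : 'rV[R]_2) (P : flat R)
    (T : affine_map R) : Prop :=
  [/\ act T (pt A) = refl_trace A B C P,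
      act T (pt B) = refl_trace B C A P
    & act T (pt C) = refl_trace C A B P].

Definition generalized_circumcenter (R : realType) (A B C : 'rV[R]_2)
    (P O : flat R) : Prop :=
  let Q := isotomcomplement A B C P in
  concurrent_at O
    (parallel_through (pt (midpoint B C)) (Q + trace A B C P))
    (parallel_through (pt (midpoint C A)) (Q + trace B C A P))
    (parallel_through (pt (midpoint A B)) (Q + trace C A B P)).

Definition generalized_orthocenter (R : realType) (A B C : 'rV[R]_2)
    (P H : flat R) : Prop :=
  let Q := isotomcomplement A B C P in
  concurrent_at H
    (parallel_through (pt A) (Q + trace A B C P))
    (parallel_through (pt B) (Q + trace B C A P))
    (parallel_through (pt C) (Q + trace C A B P)).

Lemma dim_linf (R : realType) : \dim (linf R) = 2%N.
Proof.
pose f := linfun (fun v : 'rV[R]_(2 + 1) => rsubmx v).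
have fE : (f @: fullv)%VS = fullv.
  apply/eqP; rewrite eqEsubv subvf /=; apply/subvP=> u _.
  have -> : u = f (row_mx 0 u) by rewrite lfunE /= row_mxKr.
  exact: memv_img (memvf _).
have := limg_ker_dim f fullv; rewrite fE capfv.
by rewrite !dimvf /dim /= => h; apply/eqP; rewrite -(eqn_add2r 1) h.
Qed.

Lemma parallel_throughP (R : realType) (X m l : flat R) :
    ordinary X -> is_line m -> m <> linf R ->
  l = parallel_through X m <-> [/\ is_line l, (X <= l)%VS & parallel l m].
Proof.
move=> /andP[/eqP X1 XNinf] /eqP m2 mNinf.
pose W := (m :&: linf R)%VS.
have X0 (U : flat R) : (U <= linf R)%VS -> (X :&: U = 0)%VS.
  move=> UL; apply/eqP; rewrite -dimv_eq0 eqn0Ngt; apply/negP=> XU.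
  move/negP: XNinf; apply; apply: subv_trans UL.
  suff /eqP <- : (X :&: U == X)%VS by exact: capvSr.
  by rewrite eqEdim capvSl X1.
have W1 : \dim W = 1%N.
  have := dimv_sum_cap m (linf R); rewrite m2 dim_linf -/W.
  have : (\dim (m + linf R) <= 3)%N.
    by have := dimvS (subvf (m + linf R)); rewrite dimvf /dim /=.
  have : (2 < \dim (m + linf R))%N.
    rewrite ltnNge; apply/negP=> le2; apply: mNinf.
    have sm : (m == m + linf R)%VS by rewrite eqEdim addvSl m2.
    have sL : (linf R == m + linf R)%VS by rewrite eqEdim addvSr dim_linf.
    by rewrite (eqP sm) -(eqP sL).
  by case: (\dim (m + linf R)) => [|[|[|[|n]]]] // _ _ [].
have XW2 : \dim (X + W) = 2%N.
  by rewrite dimv_disjoint_sum ?X1 ?W1 // X0 // capvSr.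
split=> [->|[/eqP l2 Xl lm]].
  split; [exact/eqP | exact: addvSl |].
  rewrite /parallel /parallel_through -/W addvC -vspace_modl ?capvSr //.
  by rewrite X0 // addv0.
apply/eqP; rewrite eq_sym eqEdim /parallel_through -lm subv_add Xl capvSl /=.
by rewrite l2 lm -/W XW2.
Qed.

(* Main.v *)
(* In barycentric coordinates with respect to the basis (A, 1), (B, 1), (C, 1)
   of R^3, put P = (x : y : z). Then D = (0 : y : z), D_3 = (0 : z : y),
   P' = (yz : zx : xy) and Q = (x(y + z) : y(z + x) : z(x + y)), where all of
   x, y, z, y + z, z + x, x + y are nonzero. Joins and meets are cross products,
   and with s = xy + yz + zx they yield
   O = (x(y + z)^2(s - x^2) : y(z + x)^2(s - y^2) : z(x + y)^2(s - z^2)).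
   The map T_{P'} sends A to (0, z, y)/(y + z), and so on; one checks that it
   takes O to K(Q), and that K takes H to O. *)
Require Import Defs.
From mathcomp Require Import all_boot all_order all_algebra.
From mathcomp Require Import reals ring.

Set Implicit Arguments.
Unset Strict Implicit.
Unset Printing Implicit Defensive.

Import Order.TTheory GRing.Theory Num.Theory.

Local Open Scope ring_scope.

(** * Coordinate triples and homogeneous vectors *)

Definition cross (R : realType) (u v : R * R * R) : R * R * R :=
  (u.1.2 * v.2 - u.2 * v.1.2, u.2 * v.1.1 - u.1.1 * v.2,
   u.1.1 * v.1.2 - u.1.2 * v.1.1).

Definition dot (R : realType) (u v : R * R * R) : R :=
  u.1.1 * v.1.1 + u.1.2 * v.1.2 + u.2 * v.2.

Definition scale3 (R : realType) (k : R) (u : R * R * R) : R * R * R :=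
  (k * u.1.1, k * u.1.2, k * u.2).

Definition hom (R : realType) (X : 'rV[R]_2) : 'rV[R]_(2 + 1) :=
  row_mx X 1%:M.

(** Polymorphic in [V] because it is used both for homogeneous rows of length 3 and for plain rows
    of length 2. *)
Definition comb (R : realType) (V : lmodType R) (a b c : V) (u : R * R * R) :
    V :=
  u.1.1 *: a + u.1.2 *: b + u.2 *: c.

Definition barycentric (R : realType) (A B C : 'rV[R]_2) (u : R * R * R) :=
  comb (hom A) (hom B) (hom C) u.

Definition affmx (R : realType) (f : affine_map R) : 'M[R]_(2 + 1) :=
  block_mx (aff_lin f) 0 (aff_tr f) 1%:M.

(** * Affine maps as block matrices on homogeneous rows *)

Section Affine.
Variable R : realType.
Implicit Types (f : affine_map R) (U V : flat R) (X Y A B C : 'rV[R]_2).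

Lemma span_scale (k : R) (v : 'rV[R]_(2 + 1)) :
  k != 0 -> <[k *: v]>%VS = <[v]>%VS.
Proof.
move=> k0; apply/eqP; rewrite eqEsubv -!memvE memvZ ?memv_line //=.
by apply/vlineP; exists k^-1; rewrite scalerA mulVf // scale1r.
Qed.

Lemma act_line f (v : 'rV[R]_(2 + 1)) : act f <[v]>%VS = <[v *m affmx f]>%VS.
Proof. by rewrite /act limg_line lfunE. Qed.

Lemma hom_affmx f X : hom X *m affmx f = hom (X *m aff_lin f + aff_tr f).
Proof. by rewrite /hom /affmx mul_row_block mulmx0 !mul1mx add0r. Qed.

Lemma act_pt f X : act f (pt X) = pt (X *m aff_lin f + aff_tr f).
Proof. by rewrite /pt act_line -/(hom X) hom_affmx. Qed.

Lemma comb_mulmx m n (a b c : 'rV[R]_m) (N : 'M_(m, n)) u :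
  comb a b c u *m N = comb (a *m N) (b *m N) (c *m N) u.
Proof. by rewrite /comb !mulmxDl -!scalemxAl. Qed.

(** The last coordinate 1 forces the proportionality factor to be 1. This turns equalities of
    projective points into equalities of vectors when the uniqueness of $T_{P'}$ is proved. *)
Lemma pt_inj : injective (@pt R).
Proof.
move=> X Y XY; have : hom X \in pt Y by rewrite -XY memv_line.
case/vlineP=> k; rewrite /hom scale_row_mx => /eq_row_mx[-> /matrixP/(_ 0 0)].
by rewrite !mxE /= mulr1 => <-; rewrite scale1r.
Qed.

Lemma hom_affine X Y (y z : R) : y + z != 0 ->
  hom ((y + z)^-1 *: (y *: X + z *: Y))
    = (y / (y + z)) *: hom X + (z / (y + z)) *: hom Y.
Proof.
move=> yz0; rewrite /hom !scale_row_mx add_row_mx scalerDr !scalerA.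
rewrite ![_^-1 * _]mulrC -[_ *: 1%:M + _]scalerDl -mulrDl divff //.
by rewrite scale1r.
Qed.

Lemma hom_homothety (c X : 'rV[R]_2) (k : R) :
  hom X *m affmx (homothety c k) = hom (c + k *: (X - c)).
Proof.
by rewrite hom_affmx /= mul_mx_scalar scalerBr addrCA addrA.
Qed.

Lemma affmx_inv f : aff_invertible f -> affmx f *m affmx (aff_inv f) = 1%:M.
Proof.
move=> fU; rewrite /affmx mulmx_block /= mulmxV // !mulmx0 !mul0mx !mul1mx.
by rewrite !addr0 add0r subrr -scalar_mx_block.
Qed.

Lemma act_inv f U : aff_invertible f -> act (aff_inv f) (act f U) = U.
Proof.
move=> fU; rewrite /act -limg_comp -[RHS]lim1g; congr (_ @: U)%VS.
apply/lfunP=> v; rewrite comp_lfunE !lfunE /= -mulmxA -/(affmx f).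
by rewrite -/(affmx (aff_inv f)) affmx_inv // mulmx1.
Qed.

Lemma homothety_invertible (c : 'rV[R]_2) (k : R) :
  k != 0 -> aff_invertible (homothety c k).
Proof.
by move=> k0; rewrite /aff_invertible /= unitmxE det_scalar unitfE expf_neq0.
Qed.

Lemma affmx_inj f g : affmx f = affmx g -> f = g.
Proof.
by case: f g => [M t] [N s] /eq_block_mx /= [-> _ -> _].
Qed.

End Affine.

(** * Barycentric coordinates with respect to the vertices *)

Section Barycentric.
Variables (R : realType) (A B C : 'rV[R]_2).
Hypothesis hABC : is_triangle A B C.
Implicit Types (X Y : 'rV[R]_2) (u v w : R * R * R).

Local Notation bary := (barycentric A B C).
Local Notation vertices := [tuple hom A; hom B; hom C].

Lemma vertices_basis : basis_of fullv vertices.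
Proof.
rewrite basisEfree subvf dimvf /dim /= andbT.
by rewrite /free !span_cons span_nil addv0 addvA (eqP hABC).
Qed.

Lemma coord_bary u (i : 'I_3) :
  coord vertices i (bary u) = tnth [tuple u.1.1; u.1.2; u.2] i.
Proof.
rewrite -[RHS](coord_sum_free _ _ (basis_free vertices_basis)).
by rewrite !big_ord_recl big_ord0 addr0 addrA.
Qed.

Lemma bary_inj : injective bary.
Proof.
move=> u v uv; have E i := congr1 (coord vertices i) uv.
move: (E 0) (E 1) (E 2); rewrite !coord_bary.
rewrite !(tnth_nth 0) /=.
by case: u v {uv E} => [[? ?] ?] [[? ?] ?] /= -> -> ->.
Qed.

Lemma bary_surj (v : 'rV[R]_(2 + 1)) : exists u, v = bary u.
Proof.
exists (coord vertices 0 v, coord vertices 1 v, coord vertices 2 v).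
rewrite {1}(coord_basis vertices_basis (memvf v)).
rewrite !big_ord_recl big_ord0 addr0 addrA.
rewrite /barycentric /comb /=.
by congr (_ *: _ + _ *: _ + _ *: _); congr (coord _ _ _); apply: val_inj.
Qed.

Lemma baryZ k u : bary (scale3 k u) = k *: bary u.
Proof. by rewrite /barycentric /comb /= !scalerDr !scalerA. Qed.

Lemma baryD u v : bary (u + v) = bary u + bary v.
Proof.
rewrite /barycentric /comb /= !scalerDl [RHS]addrACA; congr (_ + _).
by rewrite addrACA.
Qed.

Lemma span_baryZ k u : k != 0 -> <[bary (scale3 k u)]>%VS = <[bary u]>%VS.
Proof. by move=> k0; rewrite baryZ span_scale. Qed.

Lemma bary_eq0 u : (bary u == 0) = (u == 0).
Proof.
have <- : bary 0 = 0 by rewrite /barycentric /comb /= !scale0r !addr0.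
by rewrite (inj_eq bary_inj).
Qed.

Lemma bary_point u : u != 0 -> is_point <[bary u]>%VS.
Proof. by rewrite /is_point dim_vline bary_eq0 => ->. Qed.

(** * Joins and meets as cross products *)

Lemma triple_neq0 u : (u != 0) = [|| u.1.1 != 0, u.1.2 != 0 | u.2 != 0].
Proof. by case: u => [[a b] c]; rewrite !xpair_eqE !negb_and -orbA. Qed.

(** [cross u v] is a normal of the plane of u and v, and its product with w is the determinant of u,
    v, w. A nonzero normal means that u and v are independent. *)
Lemma mem_join u v w : cross u v != 0 ->
  (bary w \in (<[bary u]> + <[bary v]>)%VS) = (dot (cross u v) w == 0).
Proof.
move=> uv0; apply/idP/eqP=> [|uvw].
  case/memv_addP=> _ /vlineP[k ->] [_ /vlineP[l ->]].
  by rewrite -!baryZ -baryD => /bary_inj ->; rewrite /dot /cross /=; ring.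
(* Cramer's rule: a nonzero 2x2 minor [c] of u, v determines s and t from two of the equations, and
   the third equation follows from the vanishing determinant. *)
have [s [t ->]] : exists s t, w = scale3 s u + scale3 t v.
  move: u v w uv0 uvw => [[u1 u2] u3] [[v1 v2] v3] [[w1 w2] w3].
  rewrite triple_neq0 /dot /scale3 /cross /= => /or3P[] c0 uvw.
  - set c := (X in X != 0) in c0.
    exists ((w2 * v3 - w3 * v2) / c); exists ((u2 * w3 - u3 * w2) / c).
    congr (_, _, _) => /=; [|by rewrite /c; field..].
    by rewrite -[LHS]subr0 -(mul0r c^-1) -uvw /c; field.
  - set c := (X in X != 0) in c0.
    exists ((w3 * v1 - w1 * v3) / c); exists ((u3 * w1 - u1 * w3) / c).
    congr (_, _, _) => /=; [by rewrite /c; field| |by rewrite /c; field].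
    by rewrite -[LHS]subr0 -(mul0r c^-1) -uvw /c; field.
  - set c := (X in X != 0) in c0.
    exists ((w1 * v2 - w2 * v1) / c); exists ((u1 * w2 - u2 * w1) / c).
    congr (_, _, _) => /=; [by rewrite /c; field..|].
    by rewrite -[LHS]subr0 -(mul0r c^-1) -uvw /c; field.
by rewrite baryD !baryZ memv_add // memvZ ?memv_line.
Qed.

Lemma cross0l u : cross 0 u = 0.
Proof. by rewrite /cross /= !mul0r !subr0. Qed.

Lemma cross0r u : cross u 0 = 0.
Proof. by rewrite /cross /= !mulr0 !subr0. Qed.

Lemma cross_eq0 u v : u != 0 -> cross u v = 0 -> exists k, v = scale3 k u.
Proof.
move: u v => [[u1 u2] u3] [[v1 v2] v3].
rewrite triple_neq0 /scale3 /cross /= => /or3P u0.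
move=> -[/subr0_eq E1 /subr0_eq E2 /subr0_eq E3].
case: u0 => c0.
- by exists (v1 / u1); congr (_, _, _); apply: (mulfI c0);
    rewrite mulrA [X in _ = X * _]mulrC divfK // ?E3 -?E2 mulrC.
- by exists (v2 / u2); congr (_, _, _); apply: (mulfI c0);
    rewrite mulrA [X in _ = X * _]mulrC divfK // ?E1 -?E3 mulrC.
- by exists (v3 / u3); congr (_, _, _); apply: (mulfI c0);
    rewrite mulrA [X in _ = X * _]mulrC divfK // ?E2 -?E1 mulrC.
Qed.

Lemma orthogonal_cross u v w : cross u v != 0 -> dot u w = 0 -> dot v w = 0 ->
  exists k, w = scale3 k (cross u v).
Proof.
move=> uv0 uw vw; apply: cross_eq0 => //.
(* Expansion of the vector triple product. *)
have -> : cross (cross u v) w = scale3 (dot u w) v - scale3 (dot v w) u.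
  by rewrite /cross /scale3 /dot; congr (_, _, _) => /=; ring.
by rewrite uw vw /scale3 !mul0r subrr.
Qed.

(** The meet is spanned by the cross product of the two normals. As [scale3 k w] is nonzero, both
    normals are nonzero too, so one polynomial identity also certifies that the joins are genuine,
    distinct lines. *)
Lemma meet_joins k u v u' v' w :
    cross (cross u v) (cross u' v') = scale3 k w -> k != 0 -> w != 0 ->
  ((<[bary u]> + <[bary v]>) :&: (<[bary u']> + <[bary v']>))%VS
    = <[bary w]>%VS.
Proof.
move=> E k0 w0.
have c0 : cross (cross u v) (cross u' v') != 0.
  rewrite E -bary_eq0 baryZ scaler_eq0 (negPf k0) bary_eq0 //.
have uv0 : cross u v != 0 by apply: contraNneq c0 => ->; rewrite cross0l.
have uv0' : cross u' v' != 0 by apply: contraNneq c0 => ->; rewrite cross0r.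
apply/vspaceP=> x; have [t ->] := bary_surj x; rewrite memv_cap !mem_join //.
rewrite -(span_baryZ w k0) -E; apply/andP/idP=> [[/eqP tu /eqP tv]|].
  by have [l ->] := orthogonal_cross c0 tu tv; rewrite baryZ memvZ ?memv_line.
case/vlineP=> l; rewrite -baryZ => /bary_inj ->.
by split; apply/eqP; rewrite /dot /cross /=; ring.
Qed.

(** The second identity places the meet of the first two lines on the third. *)
Lemma concurrent_joins k l u v u' v' u'' v'' w :
    cross (cross u v) (cross u' v') = scale3 k w ->
    cross (cross u' v') (cross u'' v'') = scale3 l w ->
    k != 0 -> l != 0 -> w != 0 ->
  ((<[bary u]> + <[bary v]>) :&: (<[bary u']> + <[bary v']>)
     :&: (<[bary u'']> + <[bary v'']>))%VS = <[bary w]>%VS.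
Proof.
move=> E F k0 l0 w0; rewrite (meet_joins E) //; apply/capv_idPl.
by rewrite -(meet_joins F) // capvSr.
Qed.

(** * The line at infinity, vertices and midpoints in coordinates *)

Lemma linf_join :
  linf R = (<[bary (1, -1, 0)%R]> + <[bary (0, 1, -1)%R]>)%VS.
Proof.
apply/vspaceP=> x; have [u ->] := bary_surj x.
rewrite mem_join; last first.
  by apply/eqP=> /(congr1 snd) /= /eqP; rewrite mulr1 mulr0 subr0 oner_eq0.
rewrite /linf memv_ker lfunE /= /barycentric /comb.
rewrite !linearD !linearZ /= !row_mxKr.
(* Each vertex has last coordinate 1, so the last coordinate of [bary u] is the sum of the entries
   of u; the normal of the line at infinity is therefore (1, 1, 1). *)
rewrite -!scalerDl scaler_eq0 oner_eq0 orbF; congr (_ == _).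
by rewrite /dot /cross /=; ring.
Qed.

Lemma pt_bary :
  [/\ pt A = <[bary (1, 0, 0)%R]>%VS, pt B = <[bary (0, 1, 0)%R]>%VS
    & pt C = <[bary (0, 0, 1)%R]>%VS].
Proof.
by rewrite /barycentric /comb /= !scale0r !scale1r ?addr0 !add0r.
Qed.

Lemma pt_midpoint X Y : pt (midpoint X Y) = <[hom X + hom Y]>%VS :> flat R.
Proof.
have -> : hom X + hom Y = 2 *: hom (midpoint X Y).
  rewrite /hom /midpoint add_row_mx scale_row_mx scalerA divff ?pnatr_eq0 //.
  by rewrite scale1r scaler_nat mulr2n.
by rewrite span_scale ?pnatr_eq0.
Qed.

Lemma pt_midpoint_bary :
  [/\ pt (midpoint B C) = <[bary (0, 1, 1)%R]>%VS,
      pt (midpoint C A) = <[bary (1, 0, 1)%R]>%VS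
    & pt (midpoint A B) = <[bary (1, 1, 0)%R]>%VS].
Proof.
rewrite !pt_midpoint /barycentric /comb /= !scale0r !scale1r ?addr0 !add0r.
by rewrite [hom C + hom A]addrC.
Qed.

(** * Affine maps in barycentric coordinates *)

Lemma affine_frame A' B' C' : exists T : affine_map R,
  [/\ hom A *m affmx T = hom A', hom B *m affmx T = hom B'
    & hom C *m affmx T = hom C'].
Proof.
(* The column representing the k-th barycentric coordinate, which is a linear functional. *)
pose cf (k : 'I_3) : 'cV[R]_(2 + 1) := \col_i coord vertices k 'e_i.
have cfE (k : 'I_3) (v : 'rV[R]_(2 + 1)) : v *m cf k = (coord vertices k v)%:M.
  apply/matrixP=> i j; rewrite !ord1 !mxE /= mulr1n.
  rewrite {2}(row_sum_delta v) linear_sum; apply: eq_bigr => l _.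
  by rewrite linearZ mxE.
pose N : 'M[R]_(2 + 1, 2) := cf 0 *m A' + cf 1 *m B' + cf 2 *m C'.
have NE u : bary u *m N = comb A' B' C' u.
  rewrite !mulmxDr !mulmxA !cfE !mul_scalar_mx !coord_bary.
  by rewrite !(tnth_nth 0).
(* On vectors with last coordinate 1, the top two rows of [N] act as a linear part and the last row
   as a translation. *)
exists (AffineMap (usubmx N) (dsubmx N)).
have homE X :
    hom X *m affmx (AffineMap (usubmx N) (dsubmx N)) = hom (hom X *m N).
  by rewrite hom_affmx -[in RHS](vsubmxK N) mul_row_col mul1mx.
rewrite !homE.
have /= := NE (1, 0, 0); have /= := NE (0, 1, 0); have /= := NE (0, 0, 1).
rewrite /barycentric /comb /= !scale0r !scale1r ?addr0 !add0r.
by move=> -> -> ->.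
Qed.

Lemma bary_affmx_inj (T T' : affine_map R) :
    hom A *m affmx T = hom A *m affmx T' ->
    hom B *m affmx T = hom B *m affmx T' ->
    hom C *m affmx T = hom C *m affmx T' ->
  T = T'.
Proof.
move=> EA EB EC; apply: affmx_inj; apply/row_matrixP=> i; rewrite !rowE.
by have [u ->] := bary_surj 'e_i; rewrite !comb_mulmx EA EB EC.
Qed.

(** A vector v killed by the linear part gives a vector (v, 0) killed by the block matrix, so
    injectivity can be tested in barycentric coordinates. *)
Lemma affine_invertible (T : affine_map R) :
  (forall u, bary u *m affmx T = 0 -> u = 0) -> aff_invertible T.
Proof.
move=> T0; rewrite /aff_invertible -row_free_unit.
apply: inj_row_free => v vT; have [u uE] := bary_surj (row_mx v 0).
have /T0 u0 : bary u *m affmx T = 0.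
  by rewrite -uE mul_row_block vT !mul0mx mulmx0 !addr0 row_mx0.
have : row_mx v 0 = row_mx 0 0 :> 'rV[R]_(2 + 1).
  by rewrite uE row_mx0; apply/eqP; rewrite bary_eq0 u0.
by case/eq_row_mx.
Qed.

(** K sends each vertex to the midpoint of the opposite side; the common factor 1/2 is dropped. *)
Definition compl_coord u : R * R * R :=
  (u.1.2 + u.2, u.2 + u.1.1, u.1.1 + u.1.2).

Lemma act_complement u :
  act (complement_map A B C) <[bary u]>%VS = <[bary (compl_coord u)]>%VS.
Proof.
suff E : bary (compl_coord u) = 2 *: (bary u *m affmx (complement_map A B C)).
  by rewrite act_line E span_scale ?pnatr_eq0.
rewrite comb_mulmx !hom_homothety /centroid /barycentric /comb /hom.
rewrite /= !scale_row_mx !add_row_mx !scale_row_mx; congr row_mx.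
  by apply/rowP=> i; rewrite !mxE; field.
by apply/rowP=> i; rewrite !ord1 !mxE /=; ring.
Qed.

(** The reflection in the midpoint exchanges the two endpoints, hence the two coefficients. *)
Lemma refl_line X Y (y z : R) :
  act (point_reflection (midpoint X Y)) <[y *: hom X + z *: hom Y]>%VS
    = <[z *: hom X + y *: hom Y]>%VS.
Proof.
have E : (midpoint X Y + -1 *: (X - midpoint X Y) = Y)
       * (midpoint X Y + -1 *: (Y - midpoint X Y) = X).
  by split; apply/rowP=> i; rewrite !mxE; field.
by rewrite act_line mulmxDl -!scalemxAl !hom_homothety !E addrC.
Qed.

(** * Coordinates of the traces, of $P'$, of $Q$ and of the two centers *)

Section Configuration.
Variables x y z : R.
Hypotheses (x0 : x != 0) (y0 : y != 0) (z0 : z != 0).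
Hypotheses (yz0 : y + z != 0) (zx0 : z + x != 0) (xy0 : x + y != 0).

Let P := <[bary (x, y, z)]>%VS.

Lemma trace_bary :
  [/\ trace A B C P = <[bary (0, y, z)%R]>%VS,
      trace B C A P = <[bary (x, 0, z)%R]>%VS
    & trace C A B P = <[bary (x, y, 0)%R]>%VS].
Proof.
rewrite /trace /side; have [-> -> ->] := pt_bary.
split; apply: (meet_joins (k := 1));
  rewrite ?oner_eq0 ?triple_neq0 /= ?x0 ?y0 ?orbT //;
  by rewrite /cross /scale3; congr (_, _, _) => /=; ring.
Qed.

Lemma refl_trace_bary :
  [/\ refl_trace A B C P = <[bary (0, z, y)%R]>%VS,
      refl_trace B C A P = <[bary (z, 0, x)%R]>%VS
    & refl_trace C A B P = <[bary (y, x, 0)%R]>%VS].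
Proof.
rewrite /refl_trace; have [-> -> ->] := trace_bary.
rewrite /barycentric /comb /= !scale0r ?addr0 ?add0r.
by rewrite ![_ *: hom A + _ *: hom C]addrC !refl_line.
Qed.

Lemma isotomic_bary :
  isotomic A B C P = <[bary (y * z, z * x, x * y)]>%VS.
Proof.
rewrite /isotomic; have [-> -> ->] := refl_trace_bary.
have [-> -> ->] := pt_bary.
apply: (concurrent_joins (k := 1) (l := 1));
  rewrite ?oner_eq0 ?triple_neq0 /= ?mulf_neq0 //;
  by rewrite /cross /scale3; congr (_, _, _) => /=; ring.
Qed.

Let q := (x * (y + z), y * (z + x), z * (x + y)).

Lemma isotomcomplement_bary : isotomcomplement A B C P = <[bary q]>%VS.
Proof.
rewrite /isotomcomplement isotomic_bary act_complement.
by congr <[bary (_, _, _)]>%VS => /=; ring.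
Qed.

(** The line joining [q] and [t] has normal [cross q t] and the line at infinity has normal (1, 1,
    1), so w is the point at infinity of that line. *)
Lemma parallel_through_bary k (d t w : R * R * R) :
    cross (cross q t) (1, 1, 1) = scale3 k w -> k != 0 -> w != 0 ->
  parallel_through <[bary d]>%VS (<[bary q]> + <[bary t]>)%VS
    = (<[bary d]> + <[bary w]>)%VS.
Proof.
move=> E k0 w0; rewrite /parallel_through linf_join.
rewrite (meet_joins (k := k) (w := w)) //.
by rewrite -E /cross; congr (_, _, _) => /=; ring.
Qed.

Let s := x * y + y * z + z * x.
(* w1, w2, w3 are the points at infinity of QD, QE, QF. *)
Let w1 := (- (x * (y + z) ^+ 2), y * (s - z ^+ 2), z * (s - y ^+ 2)).
Let w2 := (x * (s - z ^+ 2), - (y * (z + x) ^+ 2), z * (s - x ^+ 2)).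
Let w3 := (x * (s - y ^+ 2), y * (s - x ^+ 2), - (z * (x + y) ^+ 2)).
Let o := (x * (y + z) ^+ 2 * (s - x ^+ 2), y * (z + x) ^+ 2 * (s - y ^+ 2),
          z * (x + y) ^+ 2 * (s - z ^+ 2)).
(** The anticomplement of [o]: these coordinates invert [compl_coord] up to a factor 2. *)
Let h := (o.1.2 + o.2 - o.1.1, o.2 + o.1.1 - o.1.2, o.1.1 + o.1.2 - o.2).

(** The base point [d] is left free so that the same three directions serve the midpoints, for O,
    and the vertices, for H. *)
Lemma parallels_bary (d : R * R * R) :
  let Q := isotomcomplement A B C P in
  [/\ parallel_through <[bary d]>%VS (Q + trace A B C P)
        = (<[bary d]> + <[bary w1]>)%VS,
      parallel_through <[bary d]>%VS (Q + trace B C A P)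
        = (<[bary d]> + <[bary w2]>)%VS
    & parallel_through <[bary d]>%VS (Q + trace C A B P)
        = (<[bary d]> + <[bary w3]>)%VS].
Proof.
rewrite /= isotomcomplement_bary; have [-> -> ->] := trace_bary.
split.
- apply: (parallel_through_bary (k := 1)); rewrite ?oner_eq0 //.
    by rewrite /cross /scale3; congr (_, _, _) => /=; rewrite /s; ring.
  by rewrite triple_neq0 /= oppr_eq0 mulf_neq0 ?expf_neq0.
- apply: (parallel_through_bary (k := 1)); rewrite ?oner_eq0 //.
    by rewrite /cross /scale3; congr (_, _, _) => /=; rewrite /s; ring.
  by rewrite triple_neq0 /= oppr_eq0 [_ * _ ^+ 2 != 0]mulf_neq0 ?orbT
    ?expf_neq0.
- apply: (parallel_through_bary (k := 1)); rewrite ?oner_eq0 //.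
    by rewrite /cross /scale3; congr (_, _, _) => /=; rewrite /s; ring.
  by rewrite triple_neq0 /= oppr_eq0 [_ * _ ^+ 2 != 0]mulf_neq0 ?orbT
    ?expf_neq0.
Qed.

Lemma circumcenter_neq0 : o != 0.
Proof.
apply/eqP=> -[] /eqP; rewrite !mulf_eq0 (negPf x0) (negPf yz0) /=.
move=> /eqP E1 /eqP; rewrite !mulf_eq0 (negPf y0) (negPf zx0) /=.
move=> /eqP E2 /eqP; rewrite !mulf_eq0 (negPf z0) (negPf xy0) /=.
(* Now $s = x^2 = y^2 = z^2$. As the pairwise sums are nonzero this means $x = y = z$, hence $s =
   3x^2$, which is absurd. The identity below is a polynomial certificate of this contradiction. *)
move=> /eqP E3; suff /eqP : 4 * (x * y * z) * (x * (y + z)) = 0.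
  by rewrite !mulf_eq0 pnatr_eq0 (negPf x0) (negPf y0) (negPf z0) (negPf yz0).
transitivity ((y + z) * (x * (y + z) * (s - x ^+ 2))
   + (x - z) * (y * (z + x) * (s - y ^+ 2))
   + (x - y) * (z * (x + y) * (s - z ^+ 2))); first by rewrite /s; ring.
by rewrite E1 E2 E3; ring.
Qed.

Lemma compl_orthocenter : compl_coord h = scale3 2 o.
Proof. by rewrite /compl_coord /scale3; congr (_, _, _) => /=; ring. Qed.

Lemma orthocenter_neq0 : h != 0.
Proof.
apply: contraNneq circumcenter_neq0 => h0.
suff /eqP : 2 *: bary o = 0 by rewrite scaler_eq0 pnatr_eq0 bary_eq0.
rewrite -baryZ -compl_orthocenter h0; apply/eqP.
by rewrite bary_eq0 /compl_coord /= addr0.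
Qed.

Lemma circumcenter_bary : generalized_circumcenter A B C P <[bary o]>%VS.
Proof.
split; first exact/bary_point/circumcenter_neq0.
have [-> -> ->] := pt_midpoint_bary.
have [-> _ _] := parallels_bary (0, 1, 1).
have [_ -> _] := parallels_bary (1, 0, 1).
have [_ _ ->] := parallels_bary (1, 1, 0).
(* The factors by which the cross products of consecutive normals exceed [o]. *)
apply: (concurrent_joins (k := 2 * z) (l := 2 * x));
  rewrite ?mulf_eq0 ?pnatr_eq0 ?circumcenter_neq0 //;
  by rewrite /cross /scale3; congr (_, _, _) => /=; rewrite /s; ring.
Qed.

Lemma orthocenter_bary : generalized_orthocenter A B C P <[bary h]>%VS.
Proof.
split; first exact/bary_point/orthocenter_neq0.
have [-> -> ->] := pt_bary.
have [-> _ _] := parallels_bary (1, 0, 0).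
have [_ -> _] := parallels_bary (0, 1, 0).
have [_ _ ->] := parallels_bary (0, 0, 1).
(* The cross products are z and x times the triple with entries $x(s-y^2)(s-z^2)$,
   $y(s-z^2)(s-x^2)$, $z(s-x^2)(s-y^2)$, and [h] is twice this triple. *)
apply: (concurrent_joins (k := z / 2) (l := x / 2));
  rewrite ?mulf_neq0 ?invr_neq0 ?pnatr_eq0 ?orthocenter_neq0 //;
  by rewrite /cross /scale3; congr (_, _, _) => /=; rewrite /s; field.
Qed.

(** * The affine map $T_{P'}$ *)

Lemma trace_map_exists : exists T : affine_map R,
  [/\ unique (sends_to_refl_traces A B C P) T, aff_invertible T
    & act T <[bary o]>%VS
        = act (complement_map A B C) (isotomcomplement A B C P)].
Proof.
(* $D_3$, $E_3$, $F_3$ as ordinary points: their coordinate sums are nonzero, so they can be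
   normalised to sum 1. *)
pose pD := (z + y)^-1 *: (z *: B + y *: C).
pose pE := (x + z)^-1 *: (x *: C + z *: A).
pose pF := (y + x)^-1 *: (y *: A + x *: B).
have zy0 : z + y != 0 by rewrite addrC.
have xz0 : x + z != 0 by rewrite addrC.
have yx0 : y + x != 0 by rewrite addrC.
have [T [TA TB TC]] := affine_frame pD pE pF.
have homD : hom pD = bary (0, z / (z + y), y / (z + y)).
  by rewrite hom_affine // /barycentric /comb /= scale0r add0r.
have homE : hom pE = bary (z / (x + z), 0, x / (x + z)).
  by rewrite hom_affine // /barycentric /comb /= scale0r addr0 addrC.
have homF : hom pF = bary (y / (y + x), x / (y + x), 0).
  by rewrite hom_affine // /barycentric /comb /= scale0r addr0.
have TE u : bary u *m affmx T =
    bary (z * (u.1.2 / (x + z)) + y * (u.2 / (y + x)),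
          z * (u.1.1 / (z + y)) + x * (u.2 / (y + x)),
          y * (u.1.1 / (z + y)) + x * (u.1.2 / (x + z))).
  rewrite comb_mulmx TA TB TC homD homE homF /comb -!baryZ -!baryD.
  by congr bary; congr (_, _, _) => /=; ring.
have [tD tE tF] : [/\ refl_trace A B C P = pt pD, refl_trace B C A P = pt pE
    & refl_trace C A B P = pt pF].
  have [-> -> ->] := refl_trace_bary.
  rewrite /pt -!/(hom _) homD homE homF.
  split; [rewrite -[RHS](@span_baryZ (z + y)) //
    | rewrite -[RHS](@span_baryZ (x + z)) //
    | rewrite -[RHS](@span_baryZ (y + x)) //]; congr <[bary _]>%VS;
  by congr (_, _, _) => /=; field.
exists T; split.
- split=> [|T' [T'A T'B T'C]].
    rewrite /sends_to_refl_traces tD tE tF.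
    by rewrite /pt !act_line -!/(hom _) TA TB TC.
  move: T'A T'B T'C; rewrite tD tE tF !act_pt.
  move=> /pt_inj T'A /pt_inj T'B /pt_inj T'C.
  by apply: bary_affmx_inj; rewrite ?TA ?TB ?TC hom_affmx ?T'A ?T'B ?T'C.
- apply: affine_invertible => -[[u1 u2] u3] /eqP; rewrite TE bary_eq0 /=.
  (* In [v1], [v2], [v3] the kernel equations form a symmetric system with zero diagonal,
     off-diagonal entries z, y, x and determinant 2xyz. *)
  set v1 := u1 / _; set v2 := u2 / _; set v3 := u3 / _ => /eqP[E1 E2 E3].
  have v10 : v1 = 0.
    apply: (mulfI (x := 2 * y * z)); rewrite ?mulf_neq0 ?pnatr_eq0 //.
    transitivity (y * (z * v1 + x * v3) + z * (y * v1 + x * v2)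
      - x * (z * v2 + y * v3)); first by ring.
    by rewrite E1 E2 E3; ring.
  have v20 : v2 = 0.
    by apply: (mulfI x0); rewrite mulr0 -E3 v10; ring.
  have v30 : v3 = 0.
    by apply: (mulfI x0); rewrite mulr0 -E2 v10; ring.
  have -> : u1 = v1 * (z + y) by rewrite divfK.
  have -> : u2 = v2 * (x + z) by rewrite divfK.
  have -> : u3 = v3 * (y + x) by rewrite divfK.
  by rewrite v10 v20 v30 !mul0r.
- rewrite isotomcomplement_bary act_complement act_line TE.
  (* T carries the triple [o] to exactly 2xyz times the coordinates of K(Q). *)
  rewrite -[RHS](@span_baryZ (2 * x * y * z)) ?mulf_neq0 ?pnatr_eq0 //.
  congr <[bary _]>%VS; rewrite /o /s /compl_coord /scale3 /=.
  by congr (_, _, _); field; rewrite ?zy0 ?xz0 ?yx0.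
Qed.

Lemma generalized_centers_bary : exists T : affine_map R,
    [/\ unique (sends_to_refl_traces A B C P) T,
        aff_invertible T
      & exists O H : flat R,
          [/\ generalized_circumcenter A B C P O,
              generalized_orthocenter A B C P H,
              O = act (aff_inv T)
                    (act (complement_map A B C) (isotomcomplement A B C P))
            & H = act (aff_inv (complement_map A B C)) (act (aff_inv T)
                    (act (complement_map A B C) (isotomcomplement A B C P)))]].
Proof.
have [T [Tu Ti TO]] := trace_map_exists; exists T; split=> //.
exists <[bary o]>%VS, <[bary h]>%VS.
rewrite -TO act_inv //; split=> //.
- exact: circumcenter_bary.
- exact: orthocenter_bary.
(* H is recovered as $K^{-1}(K(H))$, where K(H) = O by [compl_orthocenter]. *)
- rewrite -[LHS](@act_inv _ (complement_map A B C)); last first.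
    by apply: homothety_invertible; rewrite oppr_eq0 invr_eq0 pnatr_eq0.
  by rewrite act_complement compl_orthocenter span_baryZ ?pnatr_eq0.
Qed.

End Configuration.

(** * The position of P expressed by nonvanishing coordinates *)

Lemma sub_side_bary u :
  [/\ (<[bary u]> <= side B C)%VS = (u.1.1 == 0),
      (<[bary u]> <= side C A)%VS = (u.1.2 == 0)
    & (<[bary u]> <= side A B)%VS = (u.2 == 0)].
Proof.
rewrite /side; have [-> -> ->] := pt_bary; rewrite -!memvE.
rewrite !mem_join /dot /cross /= ?triple_neq0 /=;
  by rewrite !(oppr0, mul0r, mulr0, mul1r, subr0, addr0, add0r) ?oner_eq0 ?orbT.
Qed.

(** Applying $K^{-1}$ moves the incidence of K(P) with a side to one of P with an anticomplementary
    side. Contraposed, it makes the coordinates y + z, z + x, x + y of K(P) nonzero. *)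
Lemma sub_anticomplementary_side_bary u X Y :
    (<[bary (compl_coord u)]> <= side X Y)%VS ->
  (<[bary u]> <= act (aff_inv (complement_map A B C)) (side X Y))%VS.
Proof.
rewrite -act_complement => sub.
rewrite -[X in (X <= _)%VS](@act_inv _ (complement_map A B C)).
  exact: limgS.
by apply: homothety_invertible; rewrite oppr_eq0 invr_eq0 pnatr_eq0.
Qed.

Lemma point_bary (P : flat R) : is_point P -> exists u, P = <[bary u]>%VS.
Proof.
move=> /eqP P1; have [u uE] := bary_surj (vpick P); exists u.
apply/eqP; rewrite -uE eq_sym eqEdim -memvE memv_pick P1 dim_vline vpick0.
by rewrite -dimv_eq0 P1.
Qed.

End Barycentric.

Theorem theorem2p2 (R : realType) (A B C : 'rV[R]_2) (P : flat R)
    (hABC : is_triangle A B C)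
    (hP : is_point P)
    (hsides : off_sides A B C P)
    (hanti : off_anticomplementary_sides A B C P) :
  let K := complement_map A B C in
  let Q := isotomcomplement A B C P in
  exists T : affine_map R,
    [/\ unique (sends_to_refl_traces A B C P) T,
        aff_invertible T
      & exists O H : flat R,
          [/\ generalized_circumcenter A B C P O,
              generalized_orthocenter A B C P H,
              O = act (aff_inv T) (act K Q)
            & H = act (aff_inv K) (act (aff_inv T) (act K Q))]].
Proof.
move=> K Q; rewrite {}/K {}/Q.
have [[[x y] z] PE] := point_bary hABC hP; move: hsides hanti; rewrite {P hP}PE.
rewrite /off_sides /off_anticomplementary_sides.
have [-> -> ->] := sub_side_bary hABC (x, y, z) => /and3P[x0 y0 z0].
have [sA sB sC] := sub_side_bary hABC (compl_coord (x, y, z)).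
have anti X Y :=
  contraNN (@sub_anticomplementary_side_bary R A B C (x, y, z) X Y).
case/and3P=> /anti; rewrite sA => yz0 /anti; rewrite sB => zx0 /anti.
rewrite sC => xy0.
exact: generalized_centers_bary.
Qed.
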